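(* Assume $\operatorname{char}\Bbbk\ne2$. For each finitely supported sequence $\{\sigma_\ell\}_{\ell\ge0}\in\Bbbk^{\mathbb Z_{\ge0}}=\bigoplus_{\ell\ge0}\Bbbk$, the formulas $$\eta^1(a_{ji}s^\alpha)=\mathfrak q(a_{ji}s^\alpha)\sum_{\ell=0}^\infty\frac12\sigma_\ell\,a_{ji}s^{\alpha+\ell},\qquad \eta^0=\eta^2=\eta^3=\cdots=0,$$ where $\mathfrak q(a_{ji}s^\alpha):=2\alpha+|i-j|$, define a degree $1$ $A_\infty$-natural transformation $\eta_{\{\sigma_\ell\}}:\mathrm{id}\Rightarrow\mathrm{id}$, and these represent all cohomology classes of degree $1$ natural transformations exactly once: $\{\sigma_\ell\}\mapsto[\eta_{\{\sigma_\ell\}}]$ is an isomorphism $\Bbbk^{\mathbb Z_{\ge0}}\cong\mathrm{HH}^1(\Delta)=H^1\operatorname{Hom}(\mathrm{id},\mathrm{id})$.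
   Context: Let $\Bbbk$ be a field, $N\ge1$ (number of punctures). $\mathcal C$ is the $\Bbbk$-linear category (an $A_\infty$-category concentrated in degree $0$ with only $\mu^2$ nonzero) with objects $T_0,\dots,T_N$, where $\operatorname{Hom}(T_i,T_j)$ has $\Bbbk$-basis $\{a_{ji}s^\alpha\}_{\alpha\ge0}$ and composition $a_{kj}s^\beta\cdot a_{ji}s^\alpha=a_{ki}s^{\alpha+\beta+\delta(i,j,k)}$, $\delta(i,j,k)=\frac12(|i-j|+|j-k|-|i-k|)$. It is the full subcategory on generators of the Fukaya category considered; functors and natural transformations are computed on $\mathcal C$ and extended to $\mathrm{Tw}^b(\mathcal C)$. A degree $g$ pre-natural transformation $\eta:\mathrm{id}\Rightarrow\mathrm{id}$ consists of multilinear maps $\eta^d:\operatorname{Hom}(X_{d-1},X_d)\otimes\cdots\otimes\operatorname{Hom}(X_0,X_1)\to\operatorname{Hom}^{g-d}(X_0,X_d)$, $d\ge0$ ($\eta^0$ being an element of $\operatorname{Hom}^g(X_0,X_0)$ for each object); as $\mathcal C$ is in degree $0$ only $\eta^g$ can be nonzero. The differential is $$\mu^1(\eta)^d(a_d,\dots,a_1)=a_d\cdot\eta^{d-1}(a_{d-1},\dots,a_1)+(-1)^{g-1}\eta^{d-1}(a_d,\dots,a_2)\cdot a_1-\sum_{n=0}^{d-2}(-1)^{n+g-1}\eta^{d-1}(a_d,\dots,a_{n+2}\cdot a_{n+1},\dots,a_1).$$ $\eta$ is an $A_\infty$-natural transformation if $\mu^1(\eta)=0$. $\mathrm{HH}^g(\Delta)=H^g\operatorname{Hom}(\mathrm{id},\mathrm{id})$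 is the degree-$g$ cohomology of this complex (Hochschild cohomology of $\mathcal C$ with coefficients in its diagonal bimodule $\Delta$). *)

(* Defs.v *)
From HB Require Import structures.
From mathcomp Require Import all_boot all_order all_algebra.
From mathcomp Require Import boolp functions.

Set Implicit Arguments.
Unset Strict Implicit.
Unset Printing Implicit Defensive.

Import GRing.Theory.
Local Open Scope ring_scope.

(* The object T_i is the ordinal i. *)
Notation obj N := 'I_N.+1 (only parsing).

(* Every space Hom(T_i, T_j) has a basis indexed by alpha >= 0, so all of them
   are represented by the same vector space k[s] = {poly k}, the basis vector
   a_{ji} s^alpha being 'X^alpha.  The objects matter only through the
   composition law. *)
Notation mor k := {poly k} (only parsing).

Definition dist (i j : nat) : nat := `|(i%:Z - j%:Z)%R|%N.

Definition delta (i j l : nat) : nat := ((dist i j + dist j l - dist i l)./2)%N.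

(* p in Hom(T_j, T_l) after q in Hom(T_i, T_j). *)
Definition mor_comp (k : fieldType) N (i j l : obj N) (p q : mor k) : mor k :=
  p * q * 'X^(delta i j l).

Lemma comp_basis (k : fieldType) N (i j l : obj N) (beta alpha : nat) :
  mor_comp i j l 'X^beta 'X^alpha = 'X^(alpha + beta + delta i j l) :> mor k.
Proof. by rewrite /mor_comp -!exprD (addnC beta). Qed.

(* A family (eta^d)_{d >= 0}: eta d X a is the value of eta^d on the chain of
   objects X_0, ..., X_d, where a t is a morphism X_t -> X_(t+1) (so that a t
   is the argument with label t + 1 in eta^d(a_d, ..., a_1)). *)
Definition op_family (k : fieldType) (N : nat) : Type :=
  forall d : nat, ('I_d.+1 -> obj N) -> ('I_d -> mor k) -> mor k.

Section FamilyLmodule.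
Context (k : fieldType) (N : nat).
Implicit Types f g h : op_family k N.

HB.instance Definition _ := gen_eqMixin (op_family k N).
HB.instance Definition _ := gen_choiceMixin (op_family k N).

Let zero : op_family k N := fun _ _ _ => 0.
Let opp f : op_family k N := fun d X a => - f d X a.
Let add f g : op_family k N := fun d X a => f d X a + g d X a.
Let scale (c : k) f : op_family k N := fun d X a => c *: f d X a.

Lemma family_ext f g : (forall d X a, f d X a = g d X a) -> f = g.
Proof.
move=> fg; apply: functional_extensionality_dep => d.
by apply/funext => X; apply/funext => a.
Qed.

Let addA : associative add.
Proof. by move=> f g h; apply: family_ext => d X a; exact: addrA. Qed.
Let addC : commutative add.
Proof. by move=> f g; apply: family_ext => d X a; exact: addrC. Qed.
Let add0 : left_id zero add.
Proof. by move=> f; apply: family_ext => d X a; exact: add0r. Qed.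
Let addN : left_inverse zero opp add.
Proof. by move=> f; apply: family_ext => d X a; exact: addNr. Qed.

HB.instance Definition _ := GRing.isZmodule.Build (op_family k N) addA addC add0 addN.

Let scaleA (c e : k) f : scale c (scale e f) = scale (c * e) f.
Proof. by apply: family_ext => d X a; exact: scalerA. Qed.
Let scale1 : left_id 1 scale.
Proof. by move=> f; apply: family_ext => d X a; exact: scale1r. Qed.
Let scaleDr : right_distributive scale +%R.
Proof. by move=> c f g; apply: family_ext => d X a; exact: scalerDr. Qed.
Let scaleDl f : {morph scale^~ f : c e / c + e}.
Proof. by move=> c e; apply: family_ext => d X a; exact: scalerDl. Qed.

HB.instance Definition _ :=
  GRing.Zmodule_isLmodule.Build k (op_family k N) scaleA scale1 scaleDr scaleDl.

Lemma op_family0E d X a : (0 : op_family k N) d X a = 0.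
Proof. by []. Qed.

Lemma familyDE f g d X a : (f + g) d X a = f d X a + g d X a.
Proof. by []. Qed.

Lemma familyZE c f d X a : (c *: f) d X a = c *: f d X a.
Proof. by []. Qed.

End FamilyLmodule.

(* p lies in Hom^m, for a Hom space concentrated in degree 0. *)
Definition in_degree (k : fieldType) (m : int) (p : mor k) : Prop :=
  m != 0 -> p = 0.

Definition multilinear (k : fieldType) (d : nat)
    (f : ('I_d -> mor k) -> mor k) : Prop :=
  forall (a : 'I_d -> mor k) (t : 'I_d), linear (fun u => f [eta a with t |-> u]).

(* Degree g pre-natural transformations id => id. *)
Definition is_prenat (k : fieldType) N (g : int) (eta : op_family k N) : Prop :=
  forall (d : nat) (X : 'I_d.+1 -> obj N),
    multilinear (eta d X) /\ forall a, in_degree (g - d%:Z) (eta d X a).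

(* Positions t and t + 1 in a sequence with one more entry. *)
Definition pos (d : nat) (t : 'I_d) : 'I_d.+1 := widen_ord (leqnSn d) t.
Definition next_pos (d : nat) (t : 'I_d) : 'I_d.+1 := lift ord0 t.

(* The chain with a_(n+1) and a_(n+2) composed, hence without X_(n+1). *)
Definition merge_obj N (d : nat) (n : 'I_d) (X : 'I_d.+2 -> obj N) :
    'I_d.+1 -> obj N :=
  X \o lift (next_pos (pos n)).

Definition merge_mor (k : fieldType) N (d : nat) (n : 'I_d)
    (X : 'I_d.+2 -> obj N) (a : 'I_d.+1 -> mor k) (t : 'I_d) : mor k :=
  if (t < n)%N then a (pos t)
  else if t == n then
    mor_comp (X (pos (pos n))) (X (next_pos (pos n))) (X (next_pos (next_pos n)))
      (a (next_pos n)) (a (pos n))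
  else a (next_pos t).

(* The differential of a family of degree g; the component of index d + 1 has
   arguments a_(d+1), ..., a_1. *)
Definition mu1 (k : fieldType) N (g : int) (eta : op_family k N) : op_family k N :=
  fun d => match d with
  | 0 => fun _ _ => 0
  | d.+1 => fun X a =>
      mor_comp (X ord0) (X (pos ord_max)) (X ord_max)
        (a ord_max) (eta d (X \o @pos _) (a \o @pos _))
    + (-1) ^ (g - 1) *:
        mor_comp (X ord0) (X (next_pos ord0)) (X ord_max)
          (eta d (X \o @next_pos _) (a \o @next_pos _)) (a ord0)
    - \sum_(n < d) (-1) ^ (n%:Z + g - 1) *: eta d (merge_obj n X) (merge_mor n X a)
  end.
Arguments mu1 {k N} g eta d X a.

Section Cohomology.
Context (k : fieldType) (N : nat) (g : int).

Lemma is_prenat0 : is_prenat g (0 : op_family k N).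
Proof.
by move=> d X; split=> // a t c u v; rewrite !op_family0E scaler0 addr0.
Qed.

Lemma is_prenatP c (f h : op_family k N) :
  is_prenat g f -> is_prenat g h -> is_prenat g (c *: f + h).
Proof.
move=> pf ph d X; have [[mf df] [mh dh]] := (pf d X, ph d X); split.
  move=> a t b u v; rewrite !familyDE !familyZE mf mh !scalerDr !scalerA.
  by rewrite (mulrC c b) addrACA.
by move=> a gd; rewrite familyDE familyZE df // dh // scaler0 addr0.
Qed.

Lemma comp_linearl (i j l : obj N) (q : mor k) : linear (fun p => mor_comp i j l p q).
Proof. by move=> c u v; rewrite /mor_comp !mulrDl -!scalerAl. Qed.

Lemma comp_linearr (i j l : obj N) (p : mor k) : linear (mor_comp i j l p).
Proof. by move=> c u v; rewrite /mor_comp mulrDr mulrDl -scalerAr -scalerAl. Qed.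

Lemma mu1_linear : linear (@mu1 k N g).
Proof.
move=> c f h; apply: family_ext => -[|d] X a; rewrite familyDE familyZE /=.
  by rewrite scaler0 addr0.
rewrite !familyDE !familyZE comp_linearl comp_linearr.
under eq_bigr do rewrite familyDE familyZE scalerDr scalerA mulrC -scalerA.
rewrite big_split /= -scaler_sumr scalerDr scalerA mulrC -scalerA.
by rewrite (addrACA (c *: _)) opprD -(scalerN c) (addrACA (_ + _)) -!scalerDr.
Qed.

(* Degree g natural transformations. *)
Definition nat_transf : {pred op_family k N} :=
  fun eta => `[< is_prenat g eta /\ mu1 g eta = 0 >].

Lemma nat_transf_submod : submod_closed nat_transf.
Proof.
have mu10 : mu1 g 0 = 0 :> op_family k N.
  by have := mu1_linear (-1) 0 0; rewrite scaleN1r addNr scaleN1r addNr.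
split; first by apply/asboolP; split=> //; exact: is_prenat0.
move=> c f h /asboolP[pf f0] /asboolP[ph h0]; apply/asboolP.
by split; [exact: is_prenatP | rewrite mu1_linear f0 h0 scaler0 addr0].
Qed.

HB.instance Definition _ :=
  GRing.isSubmodClosed.Build k (op_family k N) nat_transf nat_transf_submod.

Record natTransf := NatTransf {
  family_of :> op_family k N;
  family_ofP : family_of \in nat_transf }.

HB.instance Definition _ := [isSub for family_of].
HB.instance Definition _ := [Choice of natTransf by <:].
HB.instance Definition _ := [SubChoice_isSubLmodule of natTransf by <:].
End Cohomology.

Section Quotient.
Context (k : fieldType) (N : nat) (g : int).

Definition coboundary : {pred natTransf k N g} :=
  fun eta => `[< exists2 theta : op_family k N,
                   is_prenat (g - 1) theta & val eta = mu1 (g - 1) theta >].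

Lemma coboundary_submod : submod_closed coboundary.
Proof.
have mu10 : mu1 (g - 1) 0 = 0 :> op_family k N.
  by have := mu1_linear (g - 1) (-1) (0 : op_family k N) 0;
     rewrite scaleN1r addNr scaleN1r addNr.
split; first by apply/asboolP; exists 0; [exact: is_prenat0 | rewrite mu10].
move=> c f h /asboolP[f' pf ef] /asboolP[h' ph eh]; apply/asboolP.
exists (c *: f' + h'); first exact: is_prenatP.
by rewrite mu1_linear -ef -eh.
Qed.

HB.instance Definition _ :=
  GRing.isSubmodClosed.Build k (natTransf k N g) coboundary coboundary_submod.

Local Open Scope quotient_scope.

(* The quotient of the degree g natural transformations by those of the form
   mu^1(theta) with theta of degree g - 1. *)
Definition HH : Type := {ideal_quot coboundary}.
HB.instance Definition _ := GRing.Zmodule.on HH.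

Definition cohomology_class (eta : natTransf k N g) : HH :=
  \pi_({ideal_quot coboundary}) eta.

Lemma cohomology_class_eq (eta theta : natTransf k N g) :
  cohomology_class eta = cohomology_class theta <-> eta - theta \in coboundary.
Proof. by rewrite Quotient.idealrBE; split=> [|] /eqP. Qed.

Lemma cohomology_class_repr (x : HH) :
  cohomology_class (repr (x : {ideal_quot coboundary})) = x.
Proof. exact: reprK. Qed.

Lemma cohomology_classD : {morph cohomology_class : f h / f + h}.
Proof. exact: (raddfD \pi_({ideal_quot coboundary})). Qed.

Let scale (c : k) (x : HH) : HH :=
  cohomology_class (c *: repr (x : {ideal_quot coboundary})).

Let class_scale c eta :
  scale c (cohomology_class eta) = cohomology_class (c *: eta).
Proof.
apply/cohomology_class_eq; rewrite -scalerBr rpredZ //.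
by apply/cohomology_class_eq; exact: cohomology_class_repr.
Qed.

Let scaleA c e x : scale c (scale e x) = scale (c * e) x.
Proof. by rewrite -[x]cohomology_class_repr !class_scale scalerA. Qed.
Let scale1 : left_id 1 scale.
Proof. by move=> x; rewrite -[x]cohomology_class_repr class_scale scale1r. Qed.
Let scaleDr : right_distributive scale +%R.
Proof.
move=> c x y; rewrite -[x]cohomology_class_repr -[y]cohomology_class_repr.
by rewrite -cohomology_classD !class_scale -cohomology_classD scalerDr.
Qed.
Let scaleDl x : {morph scale^~ x : c e / c + e}.
Proof.
move=> c e; rewrite -[x]cohomology_class_repr !class_scale.
by rewrite -cohomology_classD scalerDl.
Qed.

HB.instance Definition _ :=
  GRing.Zmodule_isLmodule.Build k HH scaleA scale1 scaleDr scaleDl.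

Lemma cohomology_class_linear : linear cohomology_class.
Proof. by move=> c f h; rewrite cohomology_classD -class_scale. Qed.

End Quotient.

Definition q_weight (i j alpha : nat) : nat := (2 * alpha + dist i j)%N.

(* A finitely supported sequence (sigma_l)_{l >= 0} is encoded as a polynomial,
   sigma_l being its coefficient sigma`_l, so that the sums over l stop at
   size sigma.  eta^1 extends the formula for eta^1(a_{ji} s^alpha) linearly. *)
Definition eta_seq (k : fieldType) (N : nat) (sigma : {poly k}) : op_family k N :=
  fun d => match d with
  | 1 => fun X a =>
      \sum_(alpha < size (a ord0)) (a ord0)`_alpha *:
        ((q_weight (X ord0) (X ord_max) alpha)%:R *:
           \sum_(l < size sigma) (2^-1 * sigma`_l) *: 'X^(alpha + l))
  | _ => fun _ _ => 0
  end.
Arguments eta_seq {k N} sigma d X a.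

Lemma eta_seq_basis (k : fieldType) (N : nat) (sigma : {poly k})
    (X : 'I_2 -> obj N) (alpha : nat) :
  eta_seq sigma 1 X (fun _ => 'X^alpha) =
    (q_weight (X ord0) (X ord_max) alpha)%:R *:
      \sum_(l < size sigma) (2^-1 * sigma`_l) *: 'X^(alpha + l).
Proof.
rewrite /= size_polyXn big_ord_recr /= coefXn eqxx scale1r big1 ?add0r //.
by move=> i _; rewrite coefXn (ltn_eqF (ltn_ord i)) scale0r.
Qed.

(* Main.v *)
Require Import Defs.
From mathcomp Require Import all_boot all_order all_algebra.
From mathcomp Require Import boolp.
From mathcomp Require Import zify ring.

Set Implicit Arguments.
Unset Strict Implicit.
Unset Printing Implicit Defensive.

Import GRing.Theory.
Local Open Scope ring_scope.

(** The category sits in degree 0, so a pre-natural transformation of degree 1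
    is its component eta^1, and closedness says that eta^1 is a derivation of
    the category: linear maps D_ij on Hom(T_i, T_j) = k[s] satisfying the
    Leibniz rule for the twisted composition ([cocycle1P]).  A transformation
    of degree 0 is a choice of theta_i in Hom(T_i, T_i), and its differential
    is the inner derivation p |-> p (theta_i - theta_j) ([coboundary1P]).  The
    theorem thus computes derivations modulo inner ones.

    The transformations of the statement are the derivations because
    q(a_ji s^alpha) = 2 alpha + |i - j| is a grading of the category: since
    2 delta(i,j,l) + |i - l| = |i - j| + |j - l|, composition adds weights.
    Multiplying the Euler derivation of a grading by a central element h of
    k[s] again gives a derivation ([euler_derivation_leibniz]).

    Conversely ([leibnizE]), let D be a derivation and e_ij = D_ij(1).
    Composing with identities gives D_ij(p) = p e_ij + p' f with f = D_ii(s)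
    independent of i and j.  As T_0 and T_1 are distinct objects, s is the
    composite a_01 a_10, so f = s (e_01 + e_10) = s h.  The Leibniz rule on
    a_lj a_ji then reads e_ij + e_jl = e_il + delta(i,j,l) h.  Halving the
    weight, e_ij - (|i - j| / 2) h is additive in (i, j), hence a difference
    theta_i - theta_j: D is (h/2) times the Euler derivation, plus an inner
    derivation.

    An inner derivation vanishes on Hom(T_i, T_i), whereas h/2 times the Euler
    derivation maps s in Hom(T_i, T_i) to s h, so no two values of h give
    cohomologous transformations. *)

(** * The defect of composition *)

Lemma distii i : dist i i = 0%N.
Proof. rewrite /dist; lia. Qed.

(** The triangle inequality and the parity of the perimeter make the truncated
    subtraction and the halving in [delta] exact. *)
Lemma double_delta i j l : (2 * delta i j l + dist i l = dist i j + dist j l)%N.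
Proof. rewrite /delta /dist; lia. Qed.

Lemma deltall i l : delta i l l = 0%N.
Proof. by have := double_delta i l l; rewrite distii; lia. Qed.

Lemma deltaii i l : delta i i l = 0%N.
Proof. by have := double_delta i i l; rewrite distii; lia. Qed.

(** * Derivations of the category *)

Section Derivations.
Context (k : fieldType).

Lemma poly_derivationE (D : {poly k} -> {poly k}) :
    linear D -> (forall p q, D (p * q) = p * D q + D p * q) ->
  forall p, D p = p^`() * D 'X.
Proof.
move=> linD leibD.
have D1 : D 1 = 0.
  by have := leibD 1 1; rewrite !mulr1 mul1r -{1}[D 1]addr0 => /addrI.
have D0 : D 0 = 0.
  by have := linD (-1) 0 0; rewrite scaleN1r oppr0 addr0 scaleN1r addNr.
have DD : {morph D : p q / p + q}.
  by move=> p q; have := linD 1 p q; rewrite !scale1r.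
have DC c : D c%:P = 0.
  by have := linD c 1 0; rewrite addr0 D0 D1 scaler0 addr0 alg_polyC.
elim/poly_ind => [|p c IHp]; first by rewrite D0 deriv0 mul0r.
rewrite DD leibD DC IHp derivD derivM derivX derivC.
ring.
Qed.

Variable N : nat.

Definition leibniz (D : 'I_N.+1 -> 'I_N.+1 -> {poly k} -> {poly k}) : Prop :=
  forall i j l p q, D i l (mor_comp i j l p q)
                    = mor_comp i j l p (D i j q) + mor_comp i j l (D j l p) q.

(** On the basis this is p = s^alpha |-> (2 alpha + |i - j|) s^alpha h: the
    operator p |-> s p' has s^alpha as eigenvector of eigenvalue alpha. *)
Definition euler_derivation (h : {poly k}) (i j : 'I_N.+1) (p : {poly k}) :=
  (2%:R * ('X * p^`()) + (dist i j)%:R * p) * h.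

Lemma mulX_derivXn n : 'X * ('X^n)^`() = n%:R * 'X^n :> {poly k}.
Proof.
rewrite derivXn mulr_natl; case: n => [|n]; first by rewrite !mulr0n mulr0.
by rewrite mulrnAr -exprS.
Qed.

(** The factor s^delta of a composition has weight 2 delta, which is exactly
    the excess of |i - j| + |j - l| over |i - l|; so weights add up. *)
Lemma euler_derivation_leibniz h : leibniz (euler_derivation h).
Proof.
move=> i j l p q; rewrite /euler_derivation /mor_comp.
have := congr1 (fun n => n%:R : {poly k}) (double_delta i j l).
rewrite natrD [(2 * _)%:R]natrM natrD !derivM => /(canRL (addKr _)) ->.
rewrite !mulrDr (mulrCA 'X (p * q)) mulX_derivXn; ring.
Qed.

(** The classification of derivations.  Two objects are needed to factor s into
    morphisms between them; this forces D s to be divisible by s and so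
    excludes d/ds itself, which is a derivation of k[s] on a single object. *)
Lemma leibnizE D : (1 <= N)%N -> 2%:R != 0 :> k ->
    (forall i j, linear (D i j)) -> leibniz D ->
  exists h theta, forall i j p,
    D i j p = euler_derivation (2^-1 *: h) i j p + p * (theta i - theta j).
Proof.
move=> N_ge1 two_neq0 linD leibD.
pose e i j := D i j 1.
pose f i := D i i 'X.
(* delta(i,i,i) = 0: the endomorphism algebra of T_i is k[s] untwisted. *)
have Dii i p : D i i p = p^`() * f i.
  apply: (poly_derivationE (linD i i)) => {}p q.
  by have := leibD i i i p q; rewrite /mor_comp deltaii expr0 !mulr1.
(* The two ways to write p : T_i -> T_j as a composite with an endomorphism p,
   of the target or of the source, applied to the generator a_ji. *)
have DijR i j p : D i j p = p * e i j + p^`() * f j.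
  have := leibD i j j p 1; rewrite /mor_comp deltall expr0 !mulr1.
  by rewrite Dii.
have DijL i j p : D i j p = p * e i j + p^`() * f i.
  have := leibD i i j 1 p; rewrite /mor_comp deltaii expr0 !mulr1 !mul1r.
  by rewrite Dii addrC (mulrC _ p).
have fE i j : f i = f j.
  have := DijL i j 'X; rewrite DijR => /addrI.
  by rewrite derivX !mul1r.
(* s is the composite a_01 a_10, as delta(0,1,0) = 1. *)
pose i0 : 'I_N.+1 := ord0.
pose i1 : 'I_N.+1 := Ordinal (N_ge1 : (1 < N.+1)%N).
pose h := e i0 i1 + e i1 i0.
have f_eq i : f i = 'X * h.
  have := leibD i0 i1 i0 1 1.
  rewrite /mor_comp (_ : delta i0 i1 i0 = 1%N) // !mul1r expr1 Dii.
  by rewrite derivX mul1r !mulr1 -mulrDl mulrC (fE i i0).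
have eE i j l : e i j + e j l = e i l + (delta i j l)%:R *: h.
  have := leibD i j l 1 1; rewrite /mor_comp !mul1r !mulr1 -mulrDl.
  rewrite DijL f_eq derivXn => eqD.
  apply: (@mulIf _ 'X^(delta i j l)); first by rewrite -size_poly_eq0 size_polyXn.
  rewrite -eqD mulrDl (mulrC (e i l)); congr (_ + _).
  case: (delta i j l) => [|n]; first by rewrite mulr0n mul0r scale0r mul0r.
  by rewrite /= -mulr_natl -!mul_polyC polyC_natr exprS; ring.
(* The additive part of e; its potential is normalized to vanish on T_0. *)
pose et i j := e i j - ((dist i j)%:R / 2%:R) *: h.
have etD i j l : et i j + et j l = et i l.
  rewrite /et addrACA eE -opprD -scalerDl -addrA -scalerBl.
  rewrite -mulrDl -natrD -double_delta natrD natrM mulrDl mulrAC divff // mul1r.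
  by rewrite opprD addrA subrr sub0r scaleNr.
exists h, (fun i => - et i0 i) => i j p.
rewrite DijL f_eq opprK -(etD i0 i j) addKr /et /euler_derivation.
have two_half : 2%:R * (2^-1)%:P = 1 :> {poly k}.
  by rewrite -polyC_natr -polyCM divff.
rewrite -!mul_polyC polyCM polyC_natr.
ring: two_half.
Qed.

End Derivations.

(** * Degree 1 cocycles and coboundaries *)

Section Degree1.
Context (k : fieldType) (N : nat).
Implicit Types (eta : op_family k N) (i j : 'I_N.+1) (p q : {poly k}).

Definition edge i j : 'I_2 -> 'I_N.+1 := fun t => if t == ord0 then i else j.

(** A morphism i -> j is a chain with one arrow; the index type of its arrows
    has a single element, so a constant function loses nothing. *)
Definition component1 eta i j p := eta 1%N (edge i j) (fun=> p).

Lemma component1E eta X a :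
  eta 1%N X a = component1 eta (X ord0) (X ord_max) (a ord0).
Proof.
rewrite /component1; congr (eta 1%N _ _); apply/funext => t.
  by rewrite /edge; case: ifPn => [/eqP->//|]; case: t => -[|[|]] // lt _;
     congr X; apply: val_inj.
by rewrite ord1.
Qed.

Lemma mu1_degree1_2 eta X a :
  mu1 1 eta 2%N X a =
  let i := X ord0 in let j := X (lift ord0 ord0) in let l := X ord_max in
  let p := a ord_max in let q := a ord0 in
  mor_comp i j l p (component1 eta i j q)
    + mor_comp i j l (component1 eta j l p) q
    - component1 eta i l (mor_comp i j l p q).
Proof.
rewrite /= big_ord1 /= !component1E /= /merge_obj /merge_mor /=.
rewrite !expr0z !scale1r.
have -> : pos ord0 = ord0 :> 'I_2 by apply: val_inj.
have -> : next_pos ord0 = ord_max :> 'I_2 by apply: val_inj.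
have -> : pos ord_max = lift ord0 ord0 :> 'I_3 by apply: val_inj.
have -> : next_pos ord0 = lift ord0 ord0 :> 'I_3 by apply: val_inj.
have -> : pos ord0 = ord0 :> 'I_3 by apply: val_inj.
have -> : next_pos ord_max = ord_max :> 'I_3 by apply: val_inj.
have -> : lift (lift ord0 ord0) ord0 = ord0 :> 'I_3 by apply: val_inj.
have -> // : lift (lift ord0 ord0) ord_max = ord_max :> 'I_3 by apply: val_inj.
Qed.

(** Hom spaces in degree 0 leave a degree g transformation only its component
    of index g, and its differential only the one of index g + 1. *)
Lemma prenat_vanish (g : int) eta d X a :
  is_prenat g eta -> g != d%:Z -> eta d X a = 0.
Proof. by move=> /(_ d X)[_ /(_ a)] eta0 neq_gd; rewrite eta0 // subr_eq0. Qed.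

Lemma mu1_vanish (g : int) eta d X a :
  is_prenat g eta -> g != d%:Z -> mu1 g eta d.+1 X a = 0.
Proof.
move=> prenat_eta neq_gd; rewrite /= !(prenat_vanish _ _ prenat_eta) //.
rewrite /mor_comp mulr0 !mul0r scaler0 addr0 sub0r big1 ?oppr0 // => n _.
by rewrite (prenat_vanish _ _ prenat_eta) ?scaler0.
Qed.

Lemma component1_linear eta i j : is_prenat 1 eta -> linear (component1 eta i j).
Proof.
move=> prenat_eta c u v.
have [lin_eta _] := prenat_eta 1%N (edge i j).
by have := lin_eta (fun=> 0) ord0 c u v; rewrite /= !component1E.
Qed.

Lemma cocycle1P eta :
  is_prenat 1 eta -> mu1 1 eta = 0 <-> leibniz (component1 eta).
Proof.
move=> prenat_eta; split=> [eta0 i j l p q | leib_eta].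
  pose X (t : 'I_3) := nth i [:: i; j; l] t.
  pose a (t : 'I_2) := nth q [:: q; p] t.
  have := mu1_degree1_2 eta X a; rewrite eta0 op_family0E /X /a /= => /eqP.
  by rewrite eq_sym subr_eq0 => /eqP.
apply: family_ext => -[|d] X a //.
move: X a; case: (eqVneq d 1%N) => [-> | neq_d1] X a; last first.
  by rewrite mu1_vanish // eq_sym.
by rewrite mu1_degree1_2 /= leib_eta subrr.
Qed.

Lemma mu1_degree0_1 eta X a :
  mu1 (1 - 1) eta 1%N X a =
  a ord0 * (eta 0%N (fun=> X ord0) (fun=> 0) - eta 0%N (fun=> X ord_max) (fun=> 0)).
Proof.
have eta0E Y b : eta 0%N Y b = eta 0%N (fun=> Y ord0) (fun=> 0).
  by congr (eta 0%N _ _); apply/funext => t; [rewrite [t]ord1 | case: t].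
rewrite /= big_ord0 subr0 (eta0E (X \o @pos _)) (eta0E (X \o @next_pos _)) /=.
rewrite !ord1.
have -> : pos ord0 = ord0 :> 'I_2 by apply: val_inj.
have -> : next_pos ord0 = ord_max :> 'I_2 by apply: val_inj.
rewrite /mor_comp deltaii deltall expr0 !mulr1.
by rewrite subrr sub0r exprN1 invrN1 scaleN1r mulrBr (mulrC _ (a _)).
Qed.

(** A chain of length 0 is an object, so a degree 0 transformation is a function
    theta on objects; the identity twists delta(i,i,j) = delta(i,j,j) = 0 make
    its differential the commutator with theta. *)
Lemma coboundary1P (eta : natTransf k N 1) :
  eta \in coboundary (g := 1) <->
  exists theta, forall i j p, component1 eta i j p = p * (theta i - theta j).
Proof.
have /asboolP[prenat_eta _] := family_ofP eta.
split=> [/asboolP[theta _ eta_theta] | [theta eta_theta]].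
  exists (fun i => theta 0%N (fun=> i) (fun=> 0)) => i j p.
  by rewrite /component1 [family_of eta]eta_theta mu1_degree0_1.
pose th : op_family k N :=
  fun d => match d with 0 => fun X _ => theta (X ord0) | _ => fun _ _ => 0 end.
have prenat_th : is_prenat (1 - 1) th.
  move=> [|d] X; split=> //.
  - by move=> a [].
  - by move=> a t c u v /=; rewrite scaler0 addr0.
apply/asboolP; exists th => //; apply: family_ext => d X a.
move: X a; case: (eqVneq d 1%N) => [-> | neq_d1] X a.
  by rewrite mu1_degree0_1 component1E eta_theta.
rewrite [LHS](prenat_vanish _ _ prenat_eta) 1?eq_sym //.
case: d neq_d1 X a => [|d] // neq_d0 X a.
by rewrite (mu1_vanish _ _ prenat_th) // eq_sym.
Qed.

(** The factor 1/2 of eta is moved onto the sequence, and the sum over l becomes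
    the product with sigma. *)
Lemma component1_eta_seq sigma i j p :
  component1 (eta_seq sigma) i j p = euler_derivation (2^-1 *: sigma) i j p.
Proof.
have seqE alpha : \sum_(l < size sigma) (2^-1 * sigma`_l) *: 'X^(alpha + l)
    = 'X^alpha * (2^-1 *: sigma).
  rewrite -[in RHS](coefK sigma) poly_def scaler_sumr mulr_sumr; apply: eq_bigr => l _.
  by rewrite scalerA -scalerAr exprD.
rewrite /component1 /= /edge /= /euler_derivation.
rewrite -[in RHS](coefK p) poly_def raddf_sum mulr_sumr !mulr_sumr -big_split mulr_suml.
apply: eq_bigr => alpha _ /=; rewrite seqE derivZ -!scalerAr mulX_derivXn.
rewrite -!mul_polyC polyC_natr /q_weight natrD natrM; ring.
Qed.

Lemma euler_derivation_linear (h : {poly k}) i j :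
  linear (euler_derivation h i j).
Proof.
move=> c u v; rewrite /euler_derivation derivD derivZ -!mul_polyC; ring.
Qed.

Lemma eta_seq_nat_transf sigma : @eta_seq k N sigma \in @nat_transf k N 1.
Proof.
have prenat_eta : is_prenat 1 (@eta_seq k N sigma).
  move=> d X; split; last by case: d X => [|[|d]].
  case: d X => [|[|d]] X a t c u v; try by rewrite /= scaler0 addr0.
  by rewrite !component1E !component1_eta_seq ord1 /= euler_derivation_linear.
apply/asboolP; split=> //; apply/(cocycle1P prenat_eta) => i j l p q.
by rewrite !component1_eta_seq; exact: euler_derivation_leibniz.
Qed.

End Degree1.

Theorem theorem9p2 (k : fieldType) (N : nat) (N_ge1 : (1 <= N)%N)
    (char_neq2 : 2%N \notin [pchar k]) :
  exists eta_nat : forall sigma : {poly k}, @eta_seq k N sigma \in @nat_transf k N 1,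
    let class_of (sigma : {poly k}) : HH k N 1 :=
      cohomology_class (NatTransf (eta_nat sigma)) in
    linear class_of /\ bijective class_of.
Proof.
have two_neq0 : 2%:R != 0 :> k.
  by apply: contra char_neq2 => two0; rewrite inE /= two0.
exists (fun sigma => eta_seq_nat_transf _ sigma) => class_of.
have component1B (eta theta : natTransf k N 1) i j p :
    component1 (eta - theta) i j p = component1 eta i j p - component1 theta i j p.
  by [].
have class_lin : linear class_of.
  move=> c u v; rewrite -cohomology_class_linear; congr cohomology_class.
  apply: val_inj; apply: family_ext => d X a /=.
  rewrite -[RHS]/(c *: eta_seq u d X a + eta_seq v d X a).
  move: X a; case: (eqVneq d 1%N) => [-> | neq_d1] X a; last first.
    by case: d neq_d1 X a => [|[|d]] // _ X a; rewrite /= scaler0 addr0.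
  rewrite !component1E !component1_eta_seq /euler_derivation.
  by rewrite -!mul_polyC; ring.
split=> //.
(* Endomorphisms detect sigma: s in Hom(T_0, T_0) is sent to s sigma. *)
have class_inj : injective class_of.
  move=> sigma tau /cohomology_class_eq/coboundary1P[theta eq_theta].
  have := eq_theta ord0 ord0 'X.
  rewrite component1B /= !component1_eta_seq subrr mulr0 -mulrBr.
  rewrite distii mul0r addr0 derivX mulr1 -scalerBr -scalerAr -mulrA => /eqP.
  rewrite -polyC_natr mul_polyC scalerA mulVf // scale1r.
  by rewrite mulf_eq0 polyX_eq0 /= subr_eq0 => /eqP.
have class_surj x : exists sigma, class_of sigma = x.
  rewrite -[x]cohomology_class_repr; set eta := repr _.
  have /asboolP[prenat_eta /(cocycle1P prenat_eta) leib_eta] := family_ofP eta.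
  have [h [theta eta_h]] := leibnizE N_ge1 two_neq0
    (fun i j => component1_linear i j prenat_eta) leib_eta.
  exists h; apply/esym/cohomology_class_eq/coboundary1P; exists theta => i j p.
  by rewrite component1B eta_h /= component1_eta_seq addrC addKr.
have [inv_class inv_classK] := choice class_surj.
by exists inv_class => // sigma; apply: class_inj.
Qed.
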